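(* Let $I_n$ denote the number of inversion sequences of length $n$ avoiding all of the patterns $100,110,120,201,210$ (with $I_0=1$). Let $X=X(z)=1+2z+5z^2+17z^3+\cdots$ be the unique formal power series in $z$ satisfying $1-X+z-zX+2zX^2-z^2X^3=0$. Then $$\sum_{n\ge0}I_nz^n=\frac{(1+z)(X-1)-z(1-z)X^2}{z(1+z)X}.$$
   Context: An inversion sequence of length $n$ is an integer sequence $(a_1,\dots,a_n)$ with $0\le a_i<i$ for all $i$. A pattern is a sequence $\sigma$ of non-negative integers containing every value from $0$ to $\max(\sigma)$; the reduction of a sequence replaces its smallest values by $0$, the next smallest by $1$, etc. A sequence $a$ contains $\sigma$ if some (not necessarily consecutive) subsequence of $a$ has reduction $\sigma$; otherwise $a$ avoids $\sigma$. Equivalently, these are the inversion sequences with no $i<j<k$ such that $a_i>a_k$. *)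

(* Defs.v *)
From HB Require Import structures.
From mathcomp Require Import all_boot all_order all_algebra.
Set Implicit Arguments. Unset Strict Implicit. Unset Printing Implicit Defensive.
Import Order.TTheory GRing.Theory Num.Theory.

Definition reduce (s : seq nat) : seq nat :=
  [seq size (undup [seq y <- s | (y < x)%N]) | x <- s].

Definition contains (a sigma : seq nat) : bool :=
  [exists m : (size a).-tuple bool, reduce (mask m a) == sigma].

Definition avoids (a sigma : seq nat) : bool := ~~ contains a sigma.

(* inversion sequence, 0-indexed: entry at position i (0-based, i.e. a_{i+1})
   satisfies a_{i+1} < i+1 *)
Definition is_invseq (a : seq nat) : bool :=
  all (fun i => (nth 0 a i < i.+1)%N) (iota 0 (size a)).

Definition avoids_all (a : seq nat) : bool :=
  [&& avoids a [:: 1; 0; 0], avoids a [:: 1; 1; 0], avoids a [:: 1; 2; 0],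
      avoids a [:: 2; 0; 1] & avoids a [:: 2; 1; 0]].

Definition seq_of_ffun n (f : {ffun 'I_n -> 'I_n}) : seq nat :=
  [seq val (f i) | i <- enum 'I_n].

(* I_n = number of inversion sequences of length n avoiding
   100, 110, 120, 201, 210 (every inversion sequence of length n has
   entries < n, so it is the image of a unique such f) *)
Definition I_count (n : nat) : nat :=
  #|[pred f : {ffun 'I_n -> 'I_n} |
      is_invseq (seq_of_ffun f) && avoids_all (seq_of_ffun f)]|.

Local Open Scope ring_scope.

Definition fps := nat -> rat.
Definition fps_add (f g : fps) : fps := fun n => f n + g n.
Definition fps_opp (f : fps) : fps := fun n => - f n.
Definition fps_mul (f g : fps) : fps :=
  fun n => \sum_(i < n.+1) f i * g (n - i)%N.
Definition fps_C (c : rat) : fps := fun n => if n == 0%N then c else 0.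
Definition fps_z : fps := fun n => if n == 1%N then 1 else 0.

Declare Scope fps_scope.
Delimit Scope fps_scope with fps.
Notation "f + g" := (fps_add f g) : fps_scope.
Notation "- f" := (fps_opp f) : fps_scope.
Notation "f - g" := (fps_add f (fps_opp g)) : fps_scope.
Notation "f * g" := (fps_mul f g) : fps_scope.
Notation "c %:S" := (fps_C c) (at level 2, format "c %:S") : fps_scope.
Notation "''z'" := fps_z : fps_scope.

Definition gfI : fps := fun n => (I_count n)%:R.

Definition X_eq (X : fps) : Prop :=
  (1%:S - X + 'z - 'z * X + 2%:S * 'z * X * X - 'z * 'z * X * X * X)%fps
  = 0%:S%fps.

(* Main.v *)
Require Import Defs.
From mathcomp Require Import all_boot all_order all_algebra.
From mathcomp Require Import zify.
From Stdlib Require Import FunctionalExtensionality Ring.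
Local Open Scope ring_scope.
Set Implicit Arguments. Unset Strict Implicit. Unset Printing Implicit Defensive.
Import GRing.Theory.

(** Avoiding the five patterns means that [a_i <= a_k] whenever [i + 2 <= k]: such
a sequence is read from left to right as a succession of single entries and of
strict descents [x > y] at adjacent positions, each block being bounded below by
the maximum [M] of what precedes it.  The number of continuations by [k] entries
depends only on the slack [h = n - M], where [n] is the current length, and the
generating functions [D_h] of these numbers satisfy a linear recurrence in [h]
with characteristic polynomial [(u - 1)^2 - z u^2 (u - 1) - z^2 u^3].  By the
cubic equation for [X], [1 / (z X)] is a root of it; the [D_h] obey the recurrence
of order two given by the two remaining roots,
[(1 + z) D_(h+2) = X ((2 - z X) D_(h+1) - D_h)].
This yields [D_0 = (1 - z X) / (1 - z - z X)] for the required series. *)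

(** * The ring of formal power series *)

Lemma fpsP (f g : fps) : f =1 g -> f = g.
Proof. exact: functional_extensionality. Qed.

Definition trunc_fps N (f : fps) : {poly rat} := \poly_(i < N.+1) f i.

Lemma coef_trunc_fps N f i : (i <= N)%N -> (trunc_fps N f)`_i = f i.
Proof. by move=> iN; rewrite coef_poly ltnS iN. Qed.

(** Coefficients up to [N] of a Cauchy product depend only on those of the factors, so commutativity
    and associativity transfer from [{poly rat}] by truncation. *)
Lemma coef_fps_mul N (p q : {poly rat}) (f g : fps) :
    (forall i, (i <= N)%N -> p`_i = f i) ->
    (forall i, (i <= N)%N -> q`_i = g i) ->
  forall i, (i <= N)%N -> (p * q)`_i = fps_mul f g i.
Proof.
move=> pf qg i iN; rewrite coefM; apply: eq_bigr => j _.
by rewrite pf ?qg //; have := ltn_ord j; lia.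
Qed.

Lemma fps_mulC f g : fps_mul f g = fps_mul g f.
Proof.
apply: fpsP => n; have T := @coef_trunc_fps n.
by rewrite -(coef_fps_mul (T f) (T g)) // mulrC; apply: coef_fps_mul (T g) (T f) _ _.
Qed.

Lemma fps_mulA f g h : fps_mul f (fps_mul g h) = fps_mul (fps_mul f g) h.
Proof.
apply: fpsP => n; have T := @coef_trunc_fps n.
have gh := coef_fps_mul (T g) (T h); have fg := coef_fps_mul (T f) (T g).
by rewrite -(coef_fps_mul (T f) gh) // mulrA; apply: coef_fps_mul fg (T h) _ _.
Qed.

Lemma fps_mul1 f : fps_mul (fps_C 1) f = f.
Proof.
apply: fpsP => n; rewrite /fps_mul big_ord_recl subn0 mul1r big1 ?addr0 // => i _.
by rewrite /fps_C /= mul0r.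
Qed.

Lemma fps_mulDl f g h :
  fps_mul (fps_add f g) h = fps_add (fps_mul f h) (fps_mul g h).
Proof.
apply: fpsP => n; rewrite /fps_mul /fps_add -big_split /=.
by apply: eq_bigr => i _; rewrite mulrDl.
Qed.

Lemma fps_add0 f : fps_add (fps_C 0) f = f.
Proof. by apply: fpsP => n; rewrite /fps_add /fps_C; case: ifP; rewrite add0r. Qed.

Lemma fps_addNr f : fps_add f (fps_opp f) = fps_C 0.
Proof. by apply: fpsP => n; rewrite /fps_add /fps_opp /fps_C subrr; case: ifP. Qed.

Lemma fps_ring_theory : ring_theory (fps_C 0) (fps_C 1) fps_add fps_mul
  (fun f g => fps_add f (fps_opp g)) fps_opp eq.
Proof.
split=> //; [exact: fps_add0 | | | exact: fps_mul1 | exact: fps_mulC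
  | exact: fps_mulA | exact: fps_mulDl | exact: fps_addNr].
- by move=> f g; apply: fpsP => n; rewrite /fps_add addrC.
- by move=> f g h; apply: fpsP => n; rewrite /fps_add addrA.
Qed.

Add Ring fps_ring : fps_ring_theory.

(** Lets [ring] compute with the coefficient 2 of the cubic, as the only constants it knows here are
    0 and 1. *)
Lemma fps_C2 : fps_C 2 = fps_add (fps_C 1) (fps_C 1).
Proof. by apply: fpsP => n; rewrite /fps_add /fps_C; case: ifP. Qed.

Lemma fps_zM0 f : fps_mul fps_z f 0%N = 0.
Proof. by rewrite /fps_mul big_ord_recl big_ord0 /fps_z /= mul0r addr0. Qed.

Lemma fps_zMS f n : fps_mul fps_z f n.+1 = f n.
Proof.
rewrite /fps_mul !big_ord_recl /fps_z /= mul0r add0r mul1r subn1 big1 ?addr0 //.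
by move=> i _; rewrite mul0r.
Qed.

(** * Fixed points, inverses and the existence of X *)

Definition causal (F : fps -> fps) := forall n f g,
  (forall i, (i <= n)%N -> f i = g i) -> F f n = F g n.

Lemma causal_id : causal id.
Proof. by move=> n f g ->. Qed.

Lemma causal_cst c : causal (fun=> c).
Proof. by []. Qed.

Lemma causal_add F G : causal F -> causal G -> causal (fun f => fps_add (F f) (G f)).
Proof. by move=> cF cG n f g fg; rewrite /fps_add (cF n f g) ?(cG n f g). Qed.

Lemma causal_opp F : causal F -> causal (fun f => fps_opp (F f)).
Proof. by move=> cF n f g fg; rewrite /fps_opp (cF n f g). Qed.

Lemma causal_mul F G : causal F -> causal G -> causal (fun f => fps_mul (F f) (G f)).
Proof.
move=> cF cG n f g fg; apply: eq_bigr => i _.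
have le_in := ltn_ord i.
by rewrite (cF i f g) ?(cG (n - i)%N f g) // => j Hj; apply: fg; lia.
Qed.

(** The factor ['z] makes coefficient [n] of the right-hand side depend only on coefficients of [f]
    below [n], so iterating from [c] stabilises coefficient by coefficient. *)
Lemma fps_fixpoint c F : causal F -> exists f, f = fps_add c (fps_mul fps_z (F f)).
Proof.
move=> cF; pose Phi f := fps_add c (fps_mul fps_z (F f)).
have PhiE n f g : (forall i, (i < n)%N -> f i = g i) -> Phi f n = Phi g n.
  rewrite /Phi /fps_add; case: n => [|n] fg; first by rewrite !fps_zM0.
  by rewrite !fps_zMS (cF n f g).
pose u k := iter k Phi c.
have ustab n k : (n < k)%N -> u k n = u n.+1 n.
  elim/ltn_ind: n k => n IHn [//|k] nk; apply: PhiE => i lt_in.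
  by transitivity (u i.+1 i); [apply: IHn | apply/esym/IHn] => //; lia.
(* The limit is read off diagonally: coefficient [n] is final after [n.+1] iterations. *)
exists (fun n => u n.+1 n); apply: fpsP => n.
by apply: PhiE => i lt_in; apply: ustab.
Qed.

(** The inverse of 1 - z a is the fixed point of b = 1 + z a b. *)
Lemma fps_inverse a : exists b,
  fps_mul (fps_add (fps_C 1) (fps_opp (fps_mul fps_z a))) b = fps_C 1.
Proof.
have [b bE] := @fps_fixpoint (fps_C 1) (fun f => fps_mul a f)
  (causal_mul (@causal_cst a) causal_id).
exists b; transitivity (b - 'z * (a * b))%fps; first by ring.
by rewrite {1}bE; ring.
Qed.

Lemma X_eq_exists : exists X, X_eq X.
Proof.
(* The cubic is rearranged as X = 1 + z F(X). *)
pose F (X : fps) := (1%:S - X + 2%:S * X * X - 'z * X * X * X)%fps.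
have cF : causal F.
  rewrite /F; repeat first [exact: causal_cst | exact: causal_id
    | exact: (causal_mul (@causal_cst _) causal_id) | apply: causal_add
    | apply: causal_opp | apply: causal_mul].
have [X XE] := @fps_fixpoint (fps_C 1) F cF; exists X; rewrite /X_eq.
transitivity (1%:S + 'z * F X - X)%fps; first by rewrite /F; ring.
by rewrite -XE; ring.
Qed.

(** * Inversion sequences without non-adjacent descents *)

(** [behead] exempts the entry adjacent to [x]. *)
Fixpoint far_mono (s : seq nat) : bool :=
  if s is x :: s' then all (leq x) (behead s') && far_mono s' else true.

Fixpoint fits n (s : seq nat) : bool :=
  if s is x :: s' then (x <= n)%N && fits n.+1 s' else true.

Lemma is_invseqE s : is_invseq s = fits 0 s.
Proof.
suff gen n : fits n s = all (fun i => (nth 0 s i < (n + i).+1)%N) (iota 0 (size s)).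
  by rewrite gen.
elim: s n => //= x s IHs n; rewrite IHs addn0 ltnS (iotaDl 1 0) all_map.
by congr andb; apply: eq_all => i /=; rewrite addSnnS.
Qed.

Lemma containsP a sigma :
  reflect (exists2 s, subseq s a & reduce s = sigma) (contains a sigma).
Proof.
apply: (iffP existsP) => [[m /eqP <-] | [s /subseqP [m sm ->] <-]].
  by exists (mask m a); rewrite ?mask_subseq.
have sm' : size m == size a by rewrite sm.
by exists (Tuple sm').
Qed.

Definition forbidden_patterns : seq (seq nat) :=
  [:: [:: 1; 0; 0]; [:: 1; 1; 0]; [:: 1; 2; 0]; [:: 2; 0; 1]; [:: 2; 1; 0]]%N.

(** When z < x, the place of y decides the pattern: 100 if y = z, 110 if y = x, 120 if y > x, 201 if
    y < z, 210 if y lies strictly between. *)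
Lemma reduce3_descent x y z :
  (reduce [:: x; y; z] \in forbidden_patterns) = (z < x)%N.
Proof.
rewrite /reduce /= !ltnn.
case: (ltngtP x y) => xy; case: (ltngtP y z) => yz; case: (ltngtP x z) => xz;
  try (by exfalso; lia); try (by []); subst;
  rewrite /= ?inE ?eqxx ?(ltn_eqF xy) ?(gtn_eqF xy) ?(ltn_eqF yz) ?(gtn_eqF yz)
    ?(ltn_eqF xz) ?(gtn_eqF xz) //=.
Qed.

Lemma avoids_allP a :
  reflect (forall x y z, subseq [:: x; y; z] a -> (x <= z)%N) (avoids_all a).
Proof.
have -> : avoids_all a = all (avoids a) forbidden_patterns by rewrite /= andbT.
apply: (iffP allP) => [Ha x y z sa | Ha p Hp].
  rewrite leqNgt -(reduce3_descent x y z); apply/negP => /Ha /containsP [].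
  by exists [:: x; y; z].
apply/containsP => -[s sa sp].
have s3 : size s = 3.
  have -> : size s = size (reduce s) by rewrite size_map.
  by rewrite sp; move: Hp; rewrite !inE => /or4P[| | |/orP[]] /eqP ->.
case: s s3 sa sp => [|x [|y [|z [|]]]] // _ /Ha le_xz sp.
by move: Hp; rewrite -sp reduce3_descent ltnNge le_xz.
Qed.

(** Two positions are at distance at least two exactly when they are the ends of a subsequence of
    length three. *)
Lemma far_monoP s :
  reflect (forall x y z, subseq [:: x; y; z] s -> (x <= z)%N) (far_mono s).
Proof.
elim: s => [|w s IHs]; first by constructor => x y z; rewrite subseq0.
apply: (iffP andP) => [[/allP ws /IHs fs] x y z /= | Hs].
  case: eqP => [-> | _]; last exact: fs.
  case: s ws {IHs fs} => // v s ws H; apply: ws => /=.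
  by move: H => /=; case: eqP => _ H;
     [rewrite -sub1seq | apply: (mem_subseq H); rewrite !inE eqxx orbT].
split; last by apply/IHs => x y z sxyz; apply: (Hs x y z);
  exact: subseq_trans sxyz (subseq_cons _ _).
case: s {IHs} Hs => // v s Hs; apply/allP => z zs.
by apply: (Hs w v z); rewrite /= !eqxx sub1seq.
Qed.

Lemma avoids_allE s : avoids_all s = far_mono s.
Proof. by apply/avoids_allP/far_monoP. Qed.

(** * Continuations of a prefix and their enumeration *)

Definition continuation M n (s : seq nat) : bool :=
  [&& all (leq M) s, fits n s & far_mono s].

(* If [y < x] the pair [x, y] is a descent, and everything after it must be at
   least [x]; otherwise [x] is the new lower bound. *)
Lemma continuation_cons M n x s :
  continuation M n (x :: s) =
  (M <= x <= n)%N &&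
  (continuation x n.+1 s ||
   (if s is y :: t then (M <= y < x)%N && continuation x n.+2 t else false)).
Proof.
case: s => [|y t]; rewrite /continuation /=; first by rewrite !andbT.
have tr (a b : nat) : (a <= b)%N -> all (leq b) t -> all (leq a) t.
  by move=> ab; apply: sub_all => i; apply: leq_trans.
have trb (a : nat) : all (leq a) t -> all (leq a) (behead t).
  by case: (t) => //= ? ? /andP[].
apply/idP/idP => [/and3P[/and3P[Mx My Mt] /and3P[xn yn ft] /and3P[xt yt mt]] |].
  rewrite Mx xn My xt ft mt yn yt /= !andbT.
  by case: (leqP x y).
case/andP => /andP[Mx xn] /orP[/and3P[/andP[xy xt] /andP[yn ft] /andP[yt mt]]
                              |/andP[/andP[My yx] /and3P[xt ft mt]]].
  by rewrite Mx xn xt yn ft yt mt (leq_trans Mx xy) (tr M x).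
rewrite Mx xn xt ft mt My (tr M x) //=.
by rewrite (trb y) ?(tr y x) //= ?andbT; lia.
Qed.

(* [M] is the maximum so far and [M + h] the index of the next position, which is
   also the largest value allowed there. *)
Fixpoint continuations k M h : seq (seq nat) :=
  if k is k1.+1 then
    [seq (M + i)%N :: s | i <- iota 0 h.+1,
                          s <- continuations k1 (M + i) (h - i).+1] ++
    (if k1 is k2.+1 then
       [seq (M + i)%N :: p
         | i <- iota 0 h.+1,
           p <- [seq (M + j)%N :: t
                  | j <- iota 0 i, t <- continuations k2 (M + i) (h - i).+2]]
     else [::])
  else [:: [::]].

Lemma continuationsS k M h :
  continuations k.+1 M h =
    [seq (M + i)%N :: s | i <- iota 0 h.+1,
                          s <- continuations k (M + i) (h - i).+1] ++
    (if k is k'.+1 then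
       [seq (M + i)%N :: p
         | i <- iota 0 h.+1,
           p <- [seq (M + j)%N :: t
                  | j <- iota 0 i, t <- continuations k' (M + i) (h - i).+2]]
     else [::]).
Proof. by []. Qed.

Lemma mem_consD (T : eqType) (I : eqType) (f : I -> T) (r : seq I)
    (A : I -> seq (seq T)) x s :
  reflect (exists i, [/\ i \in r, x = f i & s \in A i])
    (x :: s \in [seq f i :: t | i <- r, t <- A i]).
Proof.
apply: (iffP allpairsPdep) => [[i [t [ri At [-> ->]]]] | [i [ri -> As]]].
  by exists i.
by exists i, s.
Qed.

Lemma mem_nil_consD (T : eqType) (I : eqType) (f : I -> T) (r : seq I)
    (A : I -> seq (seq T)) :
  ([::] \in [seq f i :: t | i <- r, t <- A i]) = false.
Proof. by apply/negP => /allpairsPdep [i [t []]]. Qed.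

(** Bound plus slack is the index of the next position, so it grows by one after a single entry and
    by two after a descent. *)
Lemma mem_continuations k M h s :
  (s \in continuations k M h) = (size s == k) && continuation M (M + h) s.
Proof.
elim/ltn_ind: k M h s => -[|k] IHk M h s; first by rewrite inE; case: s.
rewrite continuationsS mem_cat; case: s => [|x s].
  by rewrite mem_nil_consD; case: k {IHk} => // k; rewrite mem_nil_consD.
rewrite [size _]/= eqSS continuation_cons andbCA andb_orr andb_orr; congr orb.
  apply/mem_consD/idP => [[i [ri -> Hs]] | /and3P[Mx sk Hs]].
    move: ri Hs; rewrite mem_iota IHk // => ri /andP[-> ].
    have -> : (M + i + (h - i).+1 = (M + h).+1)%N by lia.
    by move=> ->; rewrite /= andbT; lia.
  exists (x - M)%N; have xE : (M + (x - M) = x)%N by lia.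
  split; [by rewrite mem_iota; lia | by [] |].
  by rewrite xE IHk // sk; have -> : (x + (h - (x - M)).+1 = (M + h).+1)%N by lia.
case: k IHk => [|k] IHk; first by case: s => [|y t]; rewrite ?andbF.
apply/mem_consD/idP => [[i [ri -> Hs]] | ].
  case: s Hs => [|y t]; first by rewrite mem_nil_consD.
  case/mem_consD => j [rj -> ]; rewrite IHk //.
  have -> : (M + i + (h - i).+2 = (M + h).+2)%N by move: ri; rewrite mem_iota; lia.
  by case/andP => /eqP /= -> ->; move: ri rj; rewrite !mem_iota eqxx /= !andbT; lia.
case: s => [|y t]; first by rewrite !andbF.
case/and3P => Mx tk /andP[My Ht].
exists (x - M)%N; have xE : (M + (x - M) = x)%N by lia.
split; [by rewrite mem_iota; lia | by [] |].
apply/mem_consD; exists (y - M)%N.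
split; [by rewrite mem_iota; lia | by lia |].
rewrite xE IHk //.
by have -> : (x + (h - (x - M)).+2 = (M + h).+2)%N; [lia | rewrite Ht andbT].
Qed.

Lemma uniq_consD (T : eqType) (I : eqType) (f : I -> T) (r : seq I)
    (A : I -> seq (seq T)) :
  injective f -> uniq r -> (forall i, i \in r -> uniq (A i)) ->
  uniq [seq f i :: t | i <- r, t <- A i].
Proof.
move=> f_inj r_uniq A_uniq; apply: allpairs_uniq_dep => //.
by move=> [i s] [j t] _ _ /= [/f_inj <- <-].
Qed.

Lemma continuations_uniq k M h : uniq (continuations k M h).
Proof.
have addM_inj (N : nat) : injective (addn N) by move=> i j /addnI.
elim/ltn_ind: k M h => -[|k] IHk M h //.
rewrite continuationsS cat_uniq; apply/and3P; split.
- by apply: uniq_consD; rewrite ?iota_uniq // => i _; apply: IHk.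
(* The two halves are disjoint: after [M + i] the next entry is at least [M + i] in the first and
   smaller in the second. *)
- case: k IHk => // k IHk.
  apply/hasPn => s /allpairsPdep [i [p [_ /allpairsPdep [j [t [rj _ ->]]] ->]]].
  apply/negP => /mem_consD [i' [_ /addnI <-]].
  rewrite mem_continuations => /andP[_ /and3P[/= /andP[le_ij _] _ _]].
  by move: rj; rewrite mem_iota; lia.
- case: k IHk => // k IHk.
  apply: uniq_consD; rewrite ?iota_uniq // => i _.
  by apply: uniq_consD; rewrite ?iota_uniq // => j _; apply: IHk.
Qed.

Lemma size_seq_of_ffun n (f : {ffun 'I_n -> 'I_n}) : size (seq_of_ffun f) = n.
Proof. by rewrite size_map size_enum_ord. Qed.

Lemma nth_seq_of_ffun n (f : {ffun 'I_n -> 'I_n}) (i : 'I_n) :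
  nth 0%N (seq_of_ffun f) i = f i.
Proof. by rewrite (nth_map i) ?size_enum_ord // nth_ord_enum. Qed.

Lemma seq_of_ffun_inj n : injective (@seq_of_ffun n).
Proof.
by move=> f g fg; apply/ffunP => i; apply/val_inj; rewrite /= -!nth_seq_of_ffun fg.
Qed.

(** Inversion sequences are the continuations of the empty prefix, with bound and index 0; both
    lists are duplicate-free with the same members. *)
Lemma I_countE n : I_count n = size (continuations n 0 0).
Proof.
rewrite /I_count cardE -(size_map (@seq_of_ffun n)).
apply/perm_size/uniq_perm; last 1 first.
- move=> s; rewrite mem_continuations.
  have -> : continuation 0 (0 + 0) s = is_invseq s && avoids_all s.
    rewrite /continuation is_invseqE avoids_allE.
    by rewrite (_ : all (leq 0) s) //; apply/allP.
  apply/mapP/idP => [[f] | /andP[/eqP sn Hs]].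
    by rewrite mem_enum inE => Hf ->; rewrite size_seq_of_ffun eqxx.
  have lt_s (i : 'I_n) : (nth 0%N s i < n)%N.
    case/andP: Hs => /allP /(_ (i : nat)); rewrite mem_iota sn ltn_ord => /(_ isT) Hi _.
    exact: leq_trans Hi (ltn_ord i).
  have sE : s = seq_of_ffun [ffun i => Ordinal (lt_s i)].
    apply: (@eq_from_nth _ 0%N); first by rewrite size_seq_of_ffun.
    move=> i; rewrite sn => lt_in.
    by rewrite (nth_seq_of_ffun _ (Ordinal lt_in)) ffunE.
  by exists [ffun i => Ordinal (lt_s i)]; rewrite // mem_enum inE -sE.
- by rewrite (map_inj_uniq (@seq_of_ffun_inj n)) enum_uniq.
- exact: continuations_uniq.
Qed.

Lemma size_continuationsS k M h :
  size (continuations k.+1 M h) =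
  (\sum_(i < h.+1) size (continuations k (M + i) (h - i).+1) +
   \sum_(i < h.+1) (if k is k'.+1 then
      i * size (continuations k' (M + i) (h - i).+2) else 0))%N.
Proof.
have sumE (F : nat -> nat) m : sumn [seq F i | i <- iota 0 m] = (\sum_(i < m) F i)%N.
  by rewrite sumnE big_map -/(index_iota 0 m) -[in iota 0 m](subn0 m) big_mkord.
rewrite continuationsS size_cat size_allpairs_dep.
rewrite (sumE (fun i => size (continuations k (M + i) (h - i).+1))).
congr addn; case: k => [|k]; first by rewrite big1.
rewrite size_allpairs_dep.
rewrite -(sumE (fun i => i * size (continuations k (M + i) (h - i).+2))%N).
congr sumn; apply: eq_map => i.
by rewrite size_allpairs_dep sumE sum_nat_const card_ord.
Qed.

Lemma size_continuations_shift k M h :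
  size (continuations k M h) = size (continuations k 0 h).
Proof.
elim/ltn_ind: k M h => -[|k] IHk M h //; rewrite !size_continuationsS.
congr addn; apply: eq_bigr => i _; first by rewrite IHk // [RHS]IHk.
by case: k IHk => // k IHk; rewrite IHk // [in RHS]IHk.
Qed.

(** * Generating functions *)

Definition continuation_gf h : fps := fun k => (size (continuations k 0 h))%:R.

Lemma continuation_gfS h k :
  continuation_gf h k.+1 =
    \sum_(i < h.+1) continuation_gf (h - i).+1 k +
    \sum_(i < h.+1) i%:R * ('z * continuation_gf (h - i).+2)%fps k.
Proof.
rewrite /continuation_gf size_continuationsS natrD !natr_sum.
congr (_ + _); apply: eq_bigr => i _.
  by rewrite size_continuations_shift.
case: k => [|k]; first by rewrite fps_zM0 mulr0.
by rewrite fps_zMS natrM size_continuations_shift.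
Qed.

(** Passing from [h] to [h.+1] shifts the summation index by one: the first sum gains one term, and
    each weight [i] grows by one. Differencing once more removes the remaining sum. *)
Lemma continuation_gf_diff h k :
  continuation_gf h.+1 k.+1 - continuation_gf h k.+1 =
    continuation_gf h.+2 k + \sum_(i < h.+1) ('z * continuation_gf (h - i).+2)%fps k.
Proof.
have S1 : \sum_(i < h.+2) continuation_gf (h.+1 - i).+1 k =
    continuation_gf h.+2 k + \sum_(i < h.+1) continuation_gf (h - i).+1 k.
  by rewrite big_ord_recl.
have S2 : \sum_(i < h.+2) i%:R * ('z * continuation_gf (h.+1 - i).+2)%fps k =
    \sum_(i < h.+1) i%:R * ('z * continuation_gf (h - i).+2)%fps k +
    \sum_(i < h.+1) ('z * continuation_gf (h - i).+2)%fps k.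
  rewrite big_ord_recl mul0r add0r -big_split; apply: eq_bigr => i _ /=.
  by rewrite /bump -natr1 mulrDl mul1r.
apply/eqP; rewrite !continuation_gfS S1 S2 subr_eq; apply/eqP.
by rewrite -!addrA; congr (_ + _); rewrite [RHS]addrC -addrA.
Qed.

(** * The linear system in the slack and its explicit solution *)

Definition slack_system (E : nat -> fps) :=
  [/\ E 0 = (1%:S + 'z * E 1)%fps,
      E 1 = (E 0 + 'z * (E 2 + 'z * E 2))%fps &
      forall h, (E h.+2 - E h.+1 - (E h.+1 - E h) =
                 'z * (E h.+3 + 'z * E h.+3 - E h.+2))%fps].

Lemma continuation_gf_system : slack_system continuation_gf.
Proof.
have gf0 h : continuation_gf h 0%N = 1 by [].
split=> [||h]; apply: fpsP => -[|k];
  rewrite /fps_add /fps_opp ?fps_zM0 ?fps_zMS ?gf0 ?addr0 ?subrr //.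
- by rewrite continuation_gfS !big_ord_recl !big_ord0 mul0r !addr0 add0r.
- apply/eqP; rewrite addrC -subr_eq continuation_gf_diff /fps_add.
  by rewrite !big_ord_recl !big_ord0 addr0.
- rewrite !continuation_gf_diff big_ord_recl subn0 addrA [LHS]addrAC opprD.
  by rewrite -addrA; congr (_ + _); apply: subrK.
Qed.

Lemma fps_zM_eq n f g :
  (forall i, (i < n)%N -> f i = g i) -> fps_mul fps_z f n = fps_mul fps_z g n.
Proof. by case: n => [|n] fg; rewrite ?fps_zM0 ?fps_zMS ?fg. Qed.

(** The equations refer to larger [h] only behind a factor ['z], hence to lower coefficients.
    Induction on the coefficient, and inside it on [h], therefore determines everything. *)
Lemma slack_system_uniq E F : slack_system E -> slack_system F -> E =1 F.
Proof.
move=> [E0 E1 E2] [F0 F1 F2] h; apply: fpsP => n.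
elim/ltn_ind: n h => n IHn.
have e0 : E 0 n = F 0 n.
  by rewrite E0 F0 /fps_add; congr (_ + _); apply: fps_zM_eq => i /IHn.
have e1 : E 1 n = F 1 n.
  rewrite E1 F1 /fps_add e0; congr (_ + _); apply: fps_zM_eq => i lt_in.
  rewrite (IHn i) //; congr (_ + _); apply: fps_zM_eq => j lt_ji.
  exact/IHn/(ltn_trans lt_ji).
have e2 h : E h n = F h n -> E h.+1 n = F h.+1 n -> E h.+2 n = F h.+2 n.
  (* [rec] solves the second difference for its leading term. *)
  move=> eh eh1; have rec (G : nat -> fps) :
      G h.+2 n = (G h.+2 - G h.+1 - (G h.+1 - G h))%fps n + (G h.+1 n + (G h.+1 n - G h n)).
    by rewrite /fps_add /fps_opp -addrA [X in _ + X]addrC -[X in _ + X]addrA subrr addr0 subrK.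
  rewrite rec [RHS]rec E2 F2 eh eh1; congr (_ + _).
  apply: fps_zM_eq => i lt_in; rewrite /fps_add /fps_opp !(IHn i) //.
  congr (_ + _ - _); apply: fps_zM_eq => j lt_ji.
  exact/IHn/(ltn_trans lt_ji).
move=> h; suff [] : E h n = F h n /\ E h.+1 n = F h.+1 n by [].
by elim: h => // h [eh eh1]; split; rewrite ?e2.
Qed.

(** Here [w] is 1/(1 - z - zX) and [i1] is 1/(1 + z). The solution starts with (1 - zX) [w] and [w],
    values chosen to meet the two boundary equations, and continues by the recurrence of order
    two. *)
Lemma X_eq_system X w i1 :
  X_eq X ->
  ((1%:S - 'z * (X + 1%:S)) * w)%fps = (1%:S)%fps ->
  ((1%:S - 'z * - 1%:S) * i1)%fps = (1%:S)%fps ->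
  exists2 E, slack_system E & E 0 = ((1%:S - 'z * X) * w)%fps.
Proof.
rewrite /X_eq fps_C2 => XE wE iE.
pose Y := ('z * X)%fps.
pose c := (1%:S + 1%:S - Y)%fps.
pose r := (X * i1)%fps.
pose q := (1%:S + 'z - Y - Y + Y * Y)%fps.
have rE : ((1%:S + 'z) * r)%fps = X.
  transitivity (X * ((1%:S - 'z * - 1%:S) * i1))%fps; first by rewrite /r; ring.
  by rewrite iE; ring.
(* This is the cubic in the form X ((1 - zX)^2 + z) = 1 + z. *)
have qr : (q * r)%fps = (1%:S)%fps.
  transitivity ((1%:S - 'z * - 1%:S) * i1 - i1 *
     (1%:S - X + 'z - 'z * X + (1%:S + 1%:S) * 'z * X * X - 'z * 'z * X * X * X))%fps.
    by rewrite /q /r /Y; ring.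
  by rewrite XE iE; ring.
pose step (p : fps * fps) := (p.2, r * (c * p.2 - p.1))%fps.
pose E h := (iter h step ((1%:S - Y) * w, w)%fps).1.
have E2 h : E h.+2 = (r * (c * E h.+1 - E h))%fps by [].
have E0 : E 0 = ((1%:S - Y) * w)%fps by [].
have E1 : E 1 = w by [].
have E2' h : ((1%:S + 'z) * E h.+2 = X * (c * E h.+1 - E h))%fps.
  rewrite E2 -[in RHS]rE; ring.
have E2q h : (q * E h.+2 = c * E h.+1 - E h)%fps.
  transitivity ((q * r) * (c * E h.+1 - E h))%fps; first by rewrite E2; ring.
  by rewrite qr; ring.
clearbody E; exists E => //; split.
- transitivity ((1%:S - 'z * (X + 1%:S)) * w + 'z * w)%fps; last by rewrite wE E1.
  by rewrite E0 /Y; ring.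
- transitivity (E 0 + 'z * ((1%:S + 'z) * E 2))%fps; last by ring.
  by rewrite E2' E1 E0 /c /Y; ring.
- move=> h.
  (* Eliminating [E h.+3] by the recurrence leaves exactly [E2q], because [q] equals 1 + z - [c]
     [Y]. *)
  transitivity ('z * ((1%:S + 'z) * E h.+3 - E h.+2))%fps; last by ring.
  rewrite E2'.
  transitivity (E h.+2 - (1%:S + 1%:S - Y) * E h.+1 + E h - Y * E h.+1)%fps; first by ring.
  transitivity (E h.+2 - (c * E h.+1 - E h) - Y * E h.+1)%fps; first by rewrite /c; ring.
  by rewrite -E2q /q /c /Y; ring.
Qed.

Theorem mainTheorem7 :
  (exists X : fps, X_eq X) /\
  (forall X : fps, X_eq X ->
     ('z * (1%:S + 'z) * X * gfI)%fps
     = ((1%:S + 'z) * (X - 1%:S) - 'z * (1%:S - 'z) * X * X)%fps).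
Proof.
split=> [|X XE]; first exact: X_eq_exists.
have [w wE] := fps_inverse (X + 1%:S)%fps.
have [i1 iE] := fps_inverse (- 1%:S)%fps.
have [E sysE E0] := X_eq_system XE wE iE.
have -> : gfI = ((1%:S - 'z * X) * w)%fps.
  rewrite -E0 -(slack_system_uniq continuation_gf_system sysE).
  by apply: fpsP => n; rewrite /gfI I_countE.
move: XE; rewrite /X_eq fps_C2 => XE.
set R := RHS.
(* Before multiplication by [w], the polynomials z(1 + z)X(1 - zX) and [R] (1 - z - zX) differ by 1
   - z times the cubic, which vanishes. *)
transitivity (R * ((1%:S - 'z * (X + 1%:S)) * w) + w * (1%:S - 'z) *
  (1%:S - X + 'z - 'z * X + (1%:S + 1%:S) * 'z * X * X - 'z * 'z * X * X * X))%fps.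
  by rewrite /R; ring.
by rewrite wE XE; ring.
Qed.
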